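(* Let $G$ be an $(X,Y)$-bipartite graph on $n$ vertices with $|Y|\geq |X|> n/4$. If $\delta(X,Y)\geq |Y|-n/8$ and $\delta(Y,X)\geq |X|-n/8$, then in every 2-coloring of the edges of $G$ there exists a monochromatic component $H$ such that $|V(H)\cap X|\geq |X|/2$ and $|V(H)\cap Y|\geq |Y|/2$; in particular $|V(H)|\geq n/2$.
   Context: For an $(X,Y)$-bipartite graph $G$, $\delta(X,Y)$ denotes the minimum degree of a vertex of $X$ (into $Y$), and $\delta(Y,X)$ the minimum degree of a vertex of $Y$ (into $X$). In an edge-colored graph, a monochromatic component is a connected component of the subgraph formed by the edges of a single color. *)

(* Defs.v *)
From mathcomp Require Import all_boot all_order all_algebra.

Set Implicit Arguments.
Unset Strict Implicit.
Unset Printing Implicit Defensive.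

Definition simple_graph (T : finType) (e : rel T) : Prop :=
  symmetric e /\ irreflexive e.

Definition bipartite_graph (T : finType) (e : rel T) (X Y : {set T}) : Prop :=
  [/\ simple_graph e,
      X :|: Y = [set: T],
      [disjoint X & Y]
    & forall u v, e u v -> (u \in X /\ v \in Y) \/ (u \in Y /\ v \in X)].

Definition degree_into (T : finType) (e : rel T) (B : {set T}) (x : T) : nat :=
  #|[set y in B | e x y]|.

(* Every degree into B is at most #|B|, so the default value #|B| does not
   affect the minimum when A is nonempty. *)
Definition min_degree (T : finType) (e : rel T) (A B : {set T}) : nat :=
  \big[minn/#|B|]_(x in A) degree_into e B x.

(* An edge uv is identified with the unordered pair [set u; v]. A coloring is
   a total function on {set T}, but only its values on edges are ever used. *)
Definition edge_coloring (k : nat) (T : finType) := {set T} -> 'I_k.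

Definition color_rel (k : nat) (T : finType) (e : rel T)
    (c : edge_coloring k T) (i : 'I_k) : rel T :=
  [rel u v | e u v && (c [set u; v] == i)].

(* H is the vertex set of a component of the subgraph formed by the edges of
   color i; a vertex incident with no such edge is not in that subgraph. *)
Definition mono_component (k : nat) (T : finType) (e : rel T)
    (c : edge_coloring k T) (i : 'I_k) (H : {set T}) : Prop :=
  exists x : T, (exists y : T, color_rel e c i x y)
    /\ H = [set z | connect (color_rel e c i) x z].

(* Main.v *)
(** Label every vertex by its pair of (color-0, color-1) components, seen as a
    cell (row, column) of a grid: an edge joins vertices that share a row or a
    column. Two vertices of [X] have at least [|Y|/2] common neighbours, so no
    three vertices of [X] lie in pairwise distinct rows and columns, and König's
    theorem covers [X] by two lines, one of which contains at least half of [X].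
    If that line contains two cells of [X], the common neighbours of two vertices
    in these cells lie on the same line. Otherwise it is a single cell with at
    least half of [X]; every vertex of [Y] has a neighbour in it, hence [Y] is
    covered by the row and the column of this cell. *)
Require Import Defs.
From mathcomp Require Import all_boot all_order all_algebra.
From mathcomp Require Import zify lra.

Set Implicit Arguments.
Unset Strict Implicit.
Unset Printing Implicit Defensive.

Import GRing.Theory Num.Theory.

(** For [h] a row or column label, this is the part of [A] on one line of the grid. *)
Definition fiber {T : finType} {I : eqType} (A : {set T}) (h : T -> I) (a : I) :
  {set T} := [set u in A | h u == a].

Lemma min_degree_le (T : finType) (e : rel T) (A B : {set T}) (x : T) :
  x \in A -> min_degree e A B <= degree_into e B x.
Proof.
move=> xA; rewrite /min_degree.
elim: (index_enum T) (mem_index_enum x) => [//|z s IHs].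
rewrite in_cons big_cons => /predU1P[<-|/IHs le_s]; first by rewrite xA geq_minl.
by case: ifP => // _; rewrite geq_min le_s orbT.
Qed.

Lemma half_cover (T : finType) (A B C : {set T}) :
  A \subset B :|: C -> #|A| <= 2 * #|B| \/ #|A| <= 2 * #|C|.
Proof. by move/subset_leq_card; have := cardsUI B C; lia. Qed.

Section TwoLines.
Variables (T : finType) (I : eqType) (X : {set T}) (f g : T -> I).

Hypothesis no_transversal : {in X & &, forall u v w,
  f u = f v \/ f u = f w \/ f v = f w \/ g u = g v \/ g u = g w \/ g v = g w}.

(** If no line holds half of [X], then any two lines miss some vertex of [X]. Five pairs of lines
    chosen this way give [q], [r], [s], [t], [t'], and together with [p] these contain a forbidden
    triple. *)
Lemma half_line : X != set0 ->
  exists a, #|X| <= 2 * #|fiber X f a| \/ #|X| <= 2 * #|fiber X g a|.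
Proof.
move=> /set0Pn[p pX].
(* The directions [h] and [k] are free, so this serves a row with a column, two rows, or two
   columns. *)
have cover (h k : T -> I) (a b : I) :
    (exists u, [/\ u \in X, h u <> a & k u <> b]) \/
    (#|X| <= 2 * #|fiber X h a| \/ #|X| <= 2 * #|fiber X k b|).
  case: (boolP (X \subset fiber X h a :|: fiber X k b)) => [/half_cover|]; first by right.
  case/subsetPn=> u uX; rewrite !inE uX /= negb_or => /andP[/eqP ha /eqP kb].
  by left; exists u.
have [[q [qX fq gq]]|] := cover f g (f p) (g p); last by case=> ?; eauto.
have [[r [rX fr1 fr2]]|] := cover f f (f p) (f q); last by case=> ?; eauto.
have [[s [sX gs1 gs2]]|] := cover g g (g p) (g q); last by case=> ?; eauto.
have [[t [tX ft gt]]|] := cover f g (f p) (g q); last by case=> ?; eauto.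
have [[t' [tX' ft' gt']]|] := cover f g (f q) (g p); last by case=> ?; eauto.
exfalso.
have gr : g r = g p \/ g r = g q.
  by have := no_transversal pX qX rX; intuition congruence.
have fs : f s = f p \/ f s = f q.
  by have := no_transversal pX qX sX; intuition congruence.
have T1 := no_transversal rX qX sX.
have T2 := no_transversal rX pX sX.
(* If [r] is in the column of [p] and [s] in its row, then [r], [q], [s] is a forbidden triple;
   likewise [r], [p], [s] if both are on lines of [q]. In the mixed cases one row and one column
   cover [p], [q], [r], [s], and the vertex [t'] or [t] off these two lines completes a triple with
   two of them. *)
case: gr fs => gr [] fs; [by intuition congruence| | |by intuition congruence].
- have [ft'r|gt'q] : f t' = f r \/ g t' = g q.
    by have := no_transversal rX qX tX'; intuition congruence.
  + by have := no_transversal pX qX tX'; have := no_transversal pX sX tX';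
      intuition congruence.
  + by have := no_transversal rX sX tX'; have := no_transversal pX sX tX';
      intuition congruence.
- have [ftr|gtp] : f t = f r \/ g t = g p.
    by have := no_transversal rX pX tX; intuition congruence.
  + by have := no_transversal pX qX tX; have := no_transversal qX sX tX;
      intuition congruence.
  + by have := no_transversal rX sX tX; have := no_transversal qX sX tX;
      intuition congruence.
Qed.

End TwoLines.

Section Grid.
Variables (T : finType) (I : eqType) (e : rel T) (X Y : {set T}).

Definition common_nbrs (u v : T) : {set T} := [set w in Y | e u w && e v w].

Hypothesis X0 : X != set0.
Hypothesis Y0 : Y != set0.
Hypothesis half_common : {in X &, forall u v, #|Y| <= 2 * #|common_nbrs u v|}.
Hypothesis half_dominates : forall S : {set T}, S \subset X -> #|X| <= 2 * #|S| ->
  forall w, w \in Y -> exists2 u, u \in S & e u w.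

Definition half_block (h : T -> I) (a : I) :=
  #|X| <= 2 * #|fiber X h a| /\ #|Y| <= 2 * #|fiber Y h a|.

Lemma half_line_block (f g : T -> I) (a : I) :
  (forall u v, e u v -> f u = f v \/ g u = g v) ->
  #|X| <= 2 * #|fiber X f a| ->
  exists b, half_block f b \/ half_block g b.
Proof.
move=> efg leX.
have [p pF] : exists p, p \in fiber X f a.
  by apply/set0Pn; move: X0 leX; rewrite -!card_gt0; lia.
have := pF; rewrite inE => /andP[pX /eqP fp].
case: (boolP [exists q in fiber X f a, g q != g p]).
  case/exists_inP=> q; rewrite inE => /andP[qX /eqP fq] /eqP gqp.
  (* A common neighbour of [p] and [q] cannot lie in both of their distinct columns, so it shares
     the row [a] with one of them. *)
  exists a; left; split=> //; apply: leq_trans (half_common pX qX) _.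
  rewrite leq_mul2l /=; apply: subset_leq_card; apply/subsetP=> w.
  rewrite !inE => /and3P[-> /efg epw /efg eqw] /=; apply/eqP.
  by intuition congruence.
rewrite negb_exists_in => /forall_inP allg.
have gF q : q \in fiber X f a -> g q = g p by move/allg; rewrite negbK => /eqP.
have subF : fiber X f a \subset X by apply/subsetP=> u; rewrite inE => /andP[].
(* The column of the cell inherits half of [X], so whichever of the two lines takes half of [Y] will
   do. *)
have leXg : #|X| <= 2 * #|fiber X g (g p)|.
  apply: leq_trans leX _; rewrite leq_mul2l /=; apply/subset_leq_card/subsetP=> u uF.
  by rewrite inE (subsetP subF) ?gF /=.
have /half_cover : Y \subset fiber Y f a :|: fiber Y g (g p).
  apply/subsetP=> w wY; have [u uF /efg] := half_dominates subF leX wY.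
  rewrite !inE wY /= -(gF _ uF); move: uF; rewrite inE => /andP[_ /eqP <-].
  by case=> ->; rewrite eqxx ?orbT.
by case=> leY; [exists a; left|exists (g p); right].
Qed.

Lemma grid_half_block (f g : T -> I) :
  (forall u v, e u v -> f u = f v \/ g u = g v) ->
  exists a, half_block f a \/ half_block g a.
Proof.
move=> efg; have [|a []] := @half_line T I X f g _ X0; last 2 first.
- exact: half_line_block efg.
- have egf u v : e u v -> g u = g v \/ f u = f v by case/efg; tauto.
  by case/(half_line_block egf)=> b []; exists b; tauto.
move=> u v w uX vX wX.
(* A common neighbour of all three shares one of its two lines with each of them, so two of them
   meet on the same line. *)
have [/existsP[z]|] := boolP [exists z, [&& e u z, e v z & e w z]].
  by case/and3P=> /efg ? /efg ? /efg ?; intuition congruence.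
rewrite negb_exists => /forallP no_z; exfalso.
(* Otherwise the three pairwise common neighbourhoods are disjoint, each with at least half of the
   nonempty set [Y], which is too much. Stating the premise with sets allows any ordering of the
   triple. *)
have disj A B C : [set A; B; C] = [set u; v; w] ->
    common_nbrs A B :&: common_nbrs A C = set0.
  move=> ABC; apply/setP=> z; rewrite !inE; apply/negP.
  case/and4P=> /and3P[_ eA eB] _ _ eC.
  have allz t : t \in [set u; v; w] -> e t z.
    by rewrite -ABC !inE => /orP[/orP[]|] /eqP->.
  by have /negP[] := no_z z; rewrite !allz // !inE eqxx ?orbT.
have sub A B : common_nbrs A B \subset Y by apply/subsetP=> z; rewrite inE => /andP[].
have nbrsC A B : common_nbrs A B = common_nbrs B A.
  by apply/setP=> z; rewrite !inE [e A z && _]andbC.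
have Duv : common_nbrs u v :&: common_nbrs u w = set0 by apply: disj.
have Dvw : common_nbrs u v :&: common_nbrs v w = set0.
  by rewrite nbrsC; apply: disj; rewrite [[set v; u]]setUC.
have Dwu : common_nbrs u w :&: common_nbrs v w = set0.
  rewrite nbrsC [common_nbrs v w]nbrsC; apply: disj.
  by rewrite -setUA setUC.
have := cardsUI (common_nbrs u v) (common_nbrs u w).
have := cardsUI (common_nbrs u v :|: common_nbrs u w) (common_nbrs v w).
rewrite setIUl Dvw Dwu Duv setUid cards0.
have : common_nbrs u v :|: common_nbrs u w :|: common_nbrs v w \subset Y.
  by rewrite !subUset !sub.
move/subset_leq_card; have := half_common uX vX; have := half_common uX wX.
by have := half_common vX wX; move: Y0; rewrite -card_gt0; lia.
Qed.

End Grid.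

(** Both degree hypotheses have this shape; clearing the denominator lets the later counting run in
    [nat]. *)
Lemma nonneighbors_bound (T : finType) (e : rel T) (A B : {set T}) (n : nat) (x : T) :
  (#|B|%:R - n%:R / 8%:R <= (min_degree e A B)%:R :> rat)%R -> x \in A ->
  8 * #|[set y in B | ~~ e x y]| <= n.
Proof.
move=> hd /(@min_degree_le _ e A B) le_deg.
have : 8 * #|B| <= 8 * min_degree e A B + n.
  by rewrite -(ler_nat rat) natrD !natrM; lra.
have := cardsID [set y | e x y] B.
rewrite (_ : B :&: _ = [set y in B | e x y]); last by apply/setP=> y; rewrite !inE.
rewrite (_ : B :\: _ = [set y in B | ~~ e x y]); last first.
  by apply/setP=> y; rewrite !inE andbC.
by move: le_deg; rewrite /degree_into; lia.
Qed.

Section Components.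
Variables (T : finType) (e : rel T) (c : edge_coloring 2 T).
Hypothesis e_sym : symmetric e.

Lemma color_connect_sym (i : 'I_2) : connect_sym (color_rel e c i).
Proof. by apply: sym_connect_sym => u v; rewrite /color_rel /= e_sym setUC. Qed.

(** [fingraph.root] picks one representative per class of [connect], so roots serve as grid labels:
    rows for [ord0], columns for [ord_max]. *)
Lemma edge_root (u v : T) : e u v ->
  fingraph.root (color_rel e c ord0) u = fingraph.root (color_rel e c ord0) v \/
  fingraph.root (color_rel e c ord_max) u = fingraph.root (color_rel e c ord_max) v.
Proof.
move=> euv; have [c0|c1] := eqVneq (c [set u; v]) ord0; [left|right];
  apply/(fingraph.rootP (color_connect_sym _)); apply: connect1; rewrite /color_rel /= euv.
  by rewrite c0.
by apply/eqP/val_inj; case: (c _) c1 => [[|[]]].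
Qed.

(** A class of [connect] may be an isolated vertex, which [mono_component] excludes. Here the class
    meets two disjoint sets, so a path joins distinct vertices and its first edge is the one
    required. *)
Lemma root_fiber_component (i : 'I_2) (X Y : {set T}) (a : T) :
  [disjoint X & Y] ->
  fiber X (fingraph.root (color_rel e c i)) a != set0 ->
  fiber Y (fingraph.root (color_rel e c i)) a != set0 ->
  exists H, [/\ mono_component e c i H,
    H :&: X = fiber X (fingraph.root (color_rel e c i)) a &
    H :&: Y = fiber Y (fingraph.root (color_rel e c i)) a].
Proof.
move=> dXY /set0Pn[x] + /set0Pn[y].
rewrite !inE => /andP[xX /eqP rx] /andP[yY /eqP ry].
have inH z : connect (color_rel e c i) x z = (fingraph.root (color_rel e c i) z == a).
  by rewrite -(root_connect (color_connect_sym i)) rx eq_sym.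
exists [set z | connect (color_rel e c i) x z]; split; first exists x; first split=> //.
- have /connectP[[|z s] /=] : connect (color_rel e c i) x y by rewrite inH ry.
    by move=> _ yx; move: (disjointFr dXY xX); rewrite -yx yY.
  by case/andP=> exz _ _; exists z.
- by apply/setP=> z; rewrite !inE inH andbC.
- by apply/setP=> z; rewrite !inE inH andbC.
Qed.

End Components.

Local Open Scope ring_scope.

Theorem theorem7 (T : finType) (e : rel T) (X Y : {set T}) (n : nat)
    (hG : bipartite_graph e X Y)
    (hn : #|T| = n)
    (hYX : (#|X| <= #|Y|)%N)
    (hX : n%:R / 4%:R < #|X|%:R :> rat)
    (hdX : #|Y|%:R - n%:R / 8%:R <= (min_degree e X Y)%:R :> rat)
    (hdY : #|X|%:R - n%:R / 8%:R <= (min_degree e Y X)%:R :> rat)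
    (c : edge_coloring 2 T) :
  exists (i : 'I_2) (H : {set T}),
    [/\ mono_component e c i H,
        #|X|%:R / 2%:R <= #|H :&: X|%:R :> rat,
        #|Y|%:R / 2%:R <= #|H :&: Y|%:R :> rat
      & n%:R / 2%:R <= #|H|%:R :> rat].
Proof.
case: hG => [[e_sym _] covT dXY _].
have nXY : n = (#|X| + #|Y|)%N.
  by rewrite -hn -cardsT -covT cardsU disjoint_setI0 // cards0 subn0.
have ltX : (n < 4 * #|X|)%N by rewrite -(ltr_nat rat) natrM; lra.
have X_gt0 : X != set0 by rewrite -card_gt0; lia.
have Y_gt0 : Y != set0 by rewrite -card_gt0; move: X_gt0; rewrite -card_gt0; lia.
(* Each vertex of [X] misses at most n/8 of [Y], so two miss at most n/4, which is at most |Y|/2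
   because |Y| >= n/2. *)
have half_common : {in X &, forall u v, (#|Y| <= 2 * #|common_nbrs e Y u v|)%N}.
  move=> u v /(nonneighbors_bound hdX) nu /(nonneighbors_bound hdX) nv.
  have : Y \subset common_nbrs e Y u v :|:
      ([set y in Y | ~~ e u y] :|: [set y in Y | ~~ e v y]).
    by apply/subsetP=> w wY; rewrite !inE wY /=; case: (e u w); case: (e v w).
  move/subset_leq_card; have := leq_card_setU (common_nbrs e Y u v)
    ([set y in Y | ~~ e u y] :|: [set y in Y | ~~ e v y]).
  have := leq_card_setU [set y in Y | ~~ e u y] [set y in Y | ~~ e v y].
  by move=> [+ _] [+ _]; lia.
(* Since |X| > n/4, half of [X] has more than n/8 vertices, while [w] misses at most n/8. *)
have half_dominates (S : {set T}) : S \subset X -> (#|X| <= 2 * #|S|)%N ->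
    forall w, w \in Y -> exists2 u, u \in S & e u w.
  move=> SX leS w /(nonneighbors_bound hdY) nw.
  case: (boolP [exists u in S, e u w]) => [/exists_inP[u]|]; first by exists u.
  rewrite negb_exists_in => /forall_inP noS.
  have : S \subset [set u in X | ~~ e w u].
    by apply/subsetP=> u uS; rewrite inE (subsetP SX) // e_sym noS.
  by move/subset_leq_card; lia.
suff [i [a [leX leY]]] : exists i a, half_block X Y (fingraph.root (color_rel e c i)) a.
  have [||H [HH HX HY]] := @root_fiber_component T e c e_sym i X Y a dXY.
  - by rewrite -card_gt0; move: X_gt0; rewrite -card_gt0; lia.
  - by rewrite -card_gt0; move: Y_gt0; rewrite -card_gt0; lia.
  have cardH : #|H| = (#|H :&: X| + #|H :&: Y|)%N.
    rewrite -{1}[H]setIT -covT setIUr cardsU setIACA (disjoint_setI0 dXY).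
    by rewrite setI0 cards0 subn0.
  have {}leX : #|X|%:R <= 2 * #|H :&: X|%:R :> rat by rewrite HX -natrM ler_nat.
  have {}leY : #|Y|%:R <= 2 * #|H :&: Y|%:R :> rat by rewrite HY -natrM ler_nat.
  by exists i, H; split=> //; rewrite ?cardH ?nXY ?natrD; lra.
have [a [Ha|Ha]] := grid_half_block X_gt0 Y_gt0 half_common half_dominates
  (edge_root c e_sym).
- by exists ord0, a.
- by exists ord_max, a.
Qed.
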